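(* Let $Y\sim G$ be a random variable with values in $\mathbb{R}_+=[0,\infty)$ with all moments finite, i.e. $\mathbf{E}[Y^k]<\infty$ for all $k=1,2,\ldots$, whose distribution $G$ is absolutely continuous with density $g=G'$. Assume that, for some $a>1$, $g$ is continuous and strictly positive on $[a,\infty)$ and $$\int_a^\infty\frac{-\ln g(x^2)}{x^2\,\ln x}\,\mathrm{d}x=\infty .$$ In addition, assume that the function $x\mapsto\dfrac{-\ln g(x)}{\ln x}$ is monotone increasing on $[a,\infty)$ and tends to $\infty$ as $x\to\infty$. Then $Y\sim G$ satisfies Carleman's condition (Stieltjes case), $\sum_{k=1}^\infty(\mathbf{E}[Y^k])^{-1/(2k)}=\infty$, and hence $Y$ is M-determinate (on $\mathbb{R}_+$).
   Context: A random variable with values in $\mathbb{R}_+=[0,\infty)$ and all moments finite is called M-determinate on $\mathbb{R}_+$ if its distribution is the only probability distribution on $\mathbb{R}_+$ having its moment sequence. ''Monotone increasing'' is understood in the usual sense of non-decreasing. *)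

(* Defs.v *)
From HB Require Import structures.
From mathcomp Require Import all_boot all_order all_algebra.
From mathcomp Require Import all_classical all_reals all_analysis.

Set Implicit Arguments.
Unset Strict Implicit.
Unset Printing Implicit Defensive.

Import Order.TTheory GRing.Theory Num.Theory.
Import numFieldNormedType.Exports.

Local Open Scope classical_set_scope.
Local Open Scope ring_scope.

Definition moment (R : realType) (d : measure_display) (T : measurableType d)
    (P : probability T R) (Y : {RV P >-> R}) (k : nat) : \bar R :=
  'E_P[fun t => (Y t ^+ k)%R]%E.

Definition has_density (R : realType) (d : measure_display)
    (T : measurableType d) (P : probability T R) (Y : {RV P >-> R})
    (g : R -> R) : Prop :=
  [/\ measurable_fun [set: R] g,
      forall x, 0 <= g x &
      forall A : set R, measurable A ->
        (distribution P Y A = \int[lebesgue_measure]_(x in A) (g x)%:E)%E].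

(* For Y >= 0 with finite moments, all nonzero: 0 `^ r is 0 when r < 0, so the
   terms do not have the right value if Y is almost surely 0. *)
Definition carleman_stieltjes (R : realType) (d : measure_display)
    (T : measurableType d) (P : probability T R) (Y : {RV P >-> R}) : Prop :=
  (\sum_(1 <= k <oo)
     (fine (moment Y k) `^ (- ((2 * k)%:R^-1)))%:E = +oo :> \bar R)%E.

(* For Y >= 0 with finite moments. The equality of distributions is tested on
   Borel sets only: a measure is a function on all sets, unconstrained on the
   nonmeasurable ones. *)
Definition M_determinate (R : realType) (d : measure_display)
    (T : measurableType d) (P : probability T R) (Y : {RV P >-> R}) : Prop :=
  forall nu : probability (measurableTypeR R) R,
    nu `[0, +oo[%classic = 1%E ->
    (forall k : nat,
       \int[nu]_(x in `[0%R, +oo[%classic) (x ^+ k)%:E = moment Y k)%E ->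
    forall A : set R, measurable A -> nu A = distribution P Y A.

(* Main.v *)
(* Carleman's condition.  Write h x = - ln (g x) / ln x, so that g x = x^(-h x),
   and m_k = E[Y^k].  If h (x^2) >= k + 2, monotonicity of h bounds the tail of
   m_k beyond x^2 by 1, whence m_k <= 2 x^(2k), i.e. x >= b_k := (m_k / 2)^(1/2k).
   Hence h (x^2) <= 3 + #{k >= 1 | b_k <= x}; integrating this against dx / x^2
   turns the hypothesis on g into the divergence of \sum_k 1 / b_k.

   Determinacy.  Let mu and nu be two laws on the half line with moments m_k, put
   X = sqrt x, let M_n be the mean of the n-th moments of X under mu and nu, and
   F_n (t) half the difference of the integrals of X^n cos^(n) (t X).  Then
   F_n (0) = 0 for all n, and F_n obeys Taylor's formula with remainder
   M_(n+k) h^k / k!.  The sequence M is log-convex and, by Carleman's inequality,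
   \sum_n M_n / M_(n+1) diverges, so Bang's argument gives F_0 = 0: the cosine
   transforms of X agree.  Limits of powers of cosines give Gaussians in X, that
   is the Laplace transforms of X^2, and (1 - exp (-n X^2))^N with N of order
   n exp (n c) tends to the indicator of X^2 > c. *)
Require Import Defs.
From HB Require Import structures.
From mathcomp Require Import all_boot all_order all_algebra.
From mathcomp Require Import all_classical all_reals all_analysis.
From mathcomp Require Import measurable_realfun zify ring lra.

Set Implicit Arguments.
Unset Strict Implicit.
Unset Printing Implicit Defensive.

Import Order.TTheory GRing.Theory Num.Theory.
Import numFieldNormedType.Exports.

Local Open Scope classical_set_scope.
Local Open Scope ring_scope.

(** * Derivatives of the cosine and their Taylor remainder *)

Section CosineDerivatives.
Variable R : realType.

(* [cosn n] is the n-th derivative of the cosine. *)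
Definition cosn (n : nat) (x : R) : R := cos (x + (pi / 2) *+ n).

Lemma cosn_max n x : `|cosn n x| <= 1.
Proof. exact: cos_max. Qed.

Lemma cosn0 x : cosn 0 x = cos x.
Proof. by rewrite /cosn mulr0n addr0. Qed.

Lemma cosnS n x : cosn n.+1 x = - sin (x + (pi / 2) *+ n).
Proof. by rewrite /cosn mulrSr addrA cosDpihalf. Qed.

Lemma cosnSS n x : cosn n.+2 x = - cosn n x.
Proof. by rewrite cosnS mulrSr addrA sinDpihalf. Qed.

Lemma cosn_odd_at0 n : odd n -> cosn n 0 = 0.
Proof.
move=> no; rewrite -(odd_double_half n) no add1n.
elim: (n./2) => [|k IH]; first by rewrite cosnS addr0 sin0 oppr0.
by rewrite doubleS cosnSS IH oppr0.
Qed.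

Lemma is_derive_cosn n (t h : R) :
  is_derive h 1 (fun h => cosn n (t + h)) (cosn n.+1 (t + h)).
Proof.
rewrite cosnS /cosn.
apply: is_derive_eq.
by rewrite !add0r addr0 /GRing.scale/= mulr1.
Qed.

Lemma continuous_cosn n : continuous (cosn n).
Proof.
move=> x; rewrite /cosn.
have := @continuous_cos R (x + pi / 2 *+ n).
have : (fun x => x + pi / 2 *+ n) x @[x --> x] --> x + pi / 2 *+ n.
  by apply: cvgD; [exact: cvg_id | exact: cvg_cst].
exact: continuous_comp.
Qed.

Lemma measurable_cosn n : measurable_fun setT (cosn n).
Proof. by apply: measurable_realfun.continuous_measurable_fun; exact: continuous_cosn. Qed.

Lemma is_derive_monomial k (h : R) :
  is_derive h 1 (fun h => h ^+ k.+1 / k.+1`!%:R) (h ^+ k / k`!%:R).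
Proof.
have -> : (fun h : R => h ^+ k.+1 / k.+1`!%:R) = (k.+1`!%:R)^-1 \*: (id ^+ k.+1 : R -> R).
  by apply/funext => x; rewrite /= exprfctE mulrC.
apply: is_derive_eq.
rewrite /GRing.scale/= mulr1 factS natrM invfM.
have : (k.+1%:R : R) != 0 by rewrite pnatr_eq0.
have : (k`!%:R : R) != 0 by rewrite pnatr_eq0 -lt0n fact_gt0.
by move: (k`!%:R : R) (k.+1%:R : R) => u v u0 v0; field; rewrite u0 v0.
Qed.

(** Induction on [k]: the derivative in [h] of the error [D] for [cosn n] at order [k.+1] is the
    error for [cosn n.+1] at order [k]. Hence [M + D] and [M - D], which vanish at 0, do not
    decrease on the half line. *)
Lemma cosn_taylor k n t (h : R) : 0 <= h ->
  `|cosn n (t + h) - \sum_(j < k) cosn (n + j) t * (h ^+ j / j`!%:R)|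
    <= h ^+ k / k`!%:R.
Proof.
elim: k n h => [|k IH] n h h0.
  by rewrite big_ord0 subr0 expr0 fact0 divr1 cosn_max.
pose D (h : R) := cosn n (t + h) -
  \sum_(j < k.+1) cosn (n + j) t * (h ^+ j / j`!%:R).
pose D' (h : R) := cosn n.+1 (t + h) -
  \sum_(j < k) cosn (n.+1 + j) t * (h ^+ j / j`!%:R).
pose M (h : R) : R := h ^+ k.+1 / k.+1`!%:R.
have D0 : D 0 = 0.
  rewrite /D big_ord_recl/= big1 => [|i _]; last by rewrite expr0n/= mul0r mulr0.
  by rewrite !addr0 addn0 expr0 fact0 divr1 mulr1 subrr.
have M0 : M 0 = 0 by rewrite /M expr0n mul0r.
have dD (u : R) : is_derive u 1 D (D' u).
  have -> : D = (fun h => cosn n (t + h)) - (cst (cosn n t) +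
      \sum_(j < k) (cosn (n.+1 + j) t \*: (fun h : R => h ^+ j.+1 / j.+1`!%:R))).
    apply/funext => x; rewrite /D big_ord_recl/= !fctE fct_sumE addn0 expr0 fact0.
    rewrite divr1 mulr1; congr (_ - (_ + _)); apply: eq_bigr => i _.
    by rewrite /= addnS addSn.
  apply: is_deriveB; first exact: is_derive_cosn.
  rewrite -[X in is_derive _ _ _ X]add0r.
  apply: is_deriveD.
  apply: is_derive_sum => i.
  by apply: is_deriveZ; exact: is_derive_monomial.
have dM (u : R) : is_derive u 1 M (u ^+ k / k`!%:R) by exact: is_derive_monomial.
have le_of (f df : R -> R) : (forall u : R, is_derive u 1 f (df u)) ->
    (forall u, 0 <= u -> 0 <= df u) -> f 0 <= f h.
  move=> dfu df0; apply: (@ger0_derive1_ndecr R f 0 h) => //.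
  - move=> x /[!in_itv]/= /andP[x0 _].
    by rewrite derive1E (@derive_val _ _ _ _ _ _ _ (dfu x)) df0// ltW.
  - apply: continuous_subspaceT => x.
    by apply/differentiable_continuous/derivable1_diffP; have [] := dfu x.
rewrite -/(D h) -/(M h) ler_norml; apply/andP; split.
  rewrite lerNl -subr_ge0 opprK.
  have /= := le_of (M + D) _ (fun u => is_deriveD (dM u) (dD u)).
  rewrite !fctE D0 M0 addr0; apply => u u0.
  have := IH n.+1 u u0; rewrite ler_norml => /andP[+ _].
  by rewrite lerNl -subr_ge0 opprK.
rewrite -subr_ge0.
have /= := le_of (M - D) _ (fun u => is_deriveB (dM u) (dD u)).
rewrite !fctE D0 M0 subr0; apply => u u0.
by have := IH n.+1 u u0; rewrite ler_norml => /andP[_]; rewrite -subr_ge0.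
Qed.
End CosineDerivatives.

(** * Bang's quasi-analyticity argument *)

Section BangLemma.
Variable R : realType.

Lemma partial_sum_le_expR k (x : R) : 0 <= x ->
  \sum_(j < k) x ^+ j / j`!%:R <= expR x.
Proof.
move=> x0.
have -> : \sum_(j < k) x ^+ j / j`!%:R = series (exp_coeff x) k.
  by rewrite /series/= big_mkord.
apply: nondecreasing_cvgn_le; last exact: is_cvg_series_exp_coeff.
by apply/nondecreasing_series => i _ _; exact: exp_coeff_ge0.
Qed.

Lemma logconvex_ratio (M : nat -> R) : (forall n, 0 < M n) ->
  (forall n, M n.+1 ^+ 2 <= M n * M n.+2) ->
  {homo (fun n => M n.+1 / M n) : i j / (i <= j)%N >-> i <= j}.
Proof.
move=> M0 Mlc; apply: homo_leq => [//|y x z|n]; first exact: le_trans.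
by rewrite ler_pdivrMr// mulrAC ler_pdivlMr// -expr2 mulrC.
Qed.

(** The quotient of [M (n + j)] by [M n] is a product of [j] consecutive ratios, none above the
    ratio at [m]. *)
Lemma logconvex_growth (M : nat -> R) (m n j : nat) : (forall n, 0 < M n) ->
  (forall n, M n.+1 ^+ 2 <= M n * M n.+2) -> (n + j <= m.+1)%N ->
  M (n + j)%N <= M n * (M m.+1 / M m) ^+ j.
Proof.
move=> M0 Mlc; elim: j => [|j IH] njm; first by rewrite addn0 expr0 mulr1.
rewrite addnS exprSr mulrA.
have -> : M (n + j).+1 = M (n + j)%N * (M (n + j).+1 / M (n + j)%N).
  by rewrite mulrC divfK// gt_eqF.
apply: ler_pM.
- exact: ltW.
- by rewrite divr_ge0// ltW.
- by apply: IH; rewrite (leq_trans _ njm)// addnS.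
- by apply: (logconvex_ratio M0 Mlc); rewrite -ltnS -addnS.
Qed.

Variables (F : nat -> R -> R) (M : nat -> R).
Hypothesis M_gt0 : forall n, 0 < M n.
Hypothesis M_logconvex : forall n, M n.+1 ^+ 2 <= M n * M n.+2.
Hypothesis F_taylor : forall n k t h, 0 <= t -> 0 <= h ->
  `|F n (t + h) - \sum_(j < k) F (n + j)%N t * (h ^+ j / j`!%:R)|
    <= M (n + k)%N * (h ^+ k / k`!%:R).
Hypothesis F_at0 : forall n, F n 0 = 0.

Let e : R := expR 1.
Let e_gt0 : 0 < e. Proof. exact: expR_gt0. Qed.
Let e_ge0 : 0 <= e. Proof. exact: expR_ge0. Qed.

(** Expand at [t] to order [m.+1 - n]. Since [1 <= B * e ^+ m.+1], the remainder, which carries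
    [M m.+1], has the same form as the other terms; log-convexity then bounds the sum by a partial
    sum of the exponential series. *)
Lemma bang_step (m : nat) (B t h : R) : 0 <= t -> 0 <= h ->
  1 <= B * e ^+ m.+1 ->
  (forall n, (n <= m.+1)%N -> `|F n t| <= B * e ^+ n * M n) ->
  forall n, (n <= m.+1)%N ->
    `|F n (t + h)| <= B * e ^+ n * M n * expR (e * h * (M m.+1 / M m)).
Proof.
move=> t0 h0 B1 HF n nm; set k := (m.+1 - n)%N.
have nk : (n + k)%N = m.+1 by rewrite subnKC.
have B0 : 0 < B.
  have : 0 < B * e ^+ m.+1 by exact: lt_le_trans B1.
  by rewrite pmulr_lgt0// exprn_gt0.
have hj j : 0 <= h ^+ j / j`!%:R by rewrite divr_ge0// exprn_ge0.
have FS : `|F n (t + h)| <=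
    \sum_(j < k.+1) B * e ^+ (n + j) * M (n + j)%N * (h ^+ j / j`!%:R).
  rewrite -(subrK (\sum_(j < k) F (n + j)%N t * (h ^+ j / j`!%:R)) (F n (t + h))).
  rewrite (le_trans (ler_normD _ _))// big_ord_recr/= [leRHS]addrC lerD//; last first.
    rewrite (le_trans (ler_norm_sum _ _ _))// ler_sum// => j _.
    rewrite normrM (ger0_norm (hj j)) ler_wpM2r// HF//.
    by rewrite -nk leq_add2l ltnW.
  rewrite (le_trans (F_taylor _ _ t0 h0))// ler_wpM2r// nk.
  by rewrite -[leLHS]mul1r ler_wpM2r// ltW.
apply: (le_trans FS).
set r := M m.+1 / M m.
have r0 : 0 <= r by rewrite divr_ge0// ltW.
have ehr : 0 <= e * h * r by do 2!apply: mulr_ge0 => //.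
apply: (@le_trans _ _ (B * e ^+ n * M n * \sum_(j < k.+1) (e * h * r) ^+ j / j`!%:R)).
  rewrite mulr_sumr ler_sum// => j _.
  have := @logconvex_growth M m n j M_gt0 M_logconvex.
  rewrite -nk leq_add2l -ltnS ltn_ord => /(_ isT); rewrite nk -/r => Mr.
  have -> : B * e ^+ (n + j) * M (n + j)%N * (h ^+ j / j`!%:R) =
      B * e ^+ n * e ^+ j * (h ^+ j / j`!%:R) * M (n + j)%N by rewrite exprD; ring.
  have -> : B * e ^+ n * M n * ((e * h * r) ^+ j / j`!%:R) =
      B * e ^+ n * e ^+ j * (h ^+ j / j`!%:R) * (M n * r ^+ j).
    by rewrite !exprMn; ring.
  rewrite ler_wpM2l//.
  by rewrite !(mulr_ge0, exprn_ge0)// ltW.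
by rewrite ler_wpM2l ?partial_sum_le_expR// !mulr_ge0 ?exprn_ge0// ltW.
Qed.

(** Each move to the right lowers the order by one. A move of length at most [M m / M m.+1 / e]
    makes the exponential factor in [bang_step] at most [e], which is what passing from [e ^- m.+1]
    to [e ^- m] allows. *)
Lemma bang_descent (d m : nat) (t : R) : 0 <= t ->
  t <= \sum_(m <= i < m + d) (M i / M i.+1) / e ->
  forall n, (n <= m)%N -> `|F n t| <= e ^- m * e ^+ n * M n.
Proof.
elim: d m t => [|d IH] m t t0.
  rewrite addn0 big_geq// => t1 n nm.
  have -> : t = 0 by apply/eqP; rewrite eq_le t1.
  by rewrite F_at0 normr0 !mulr_ge0 ?invr_ge0 ?exprn_ge0// ltW.
rewrite addnS big_ltn ?ltnS ?leq_addr// -addSn => tS n nm.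
set S := \sum_(_ <= _ < _) _ in tS.
have S0 : 0 <= S.
  by apply: sumr_ge0 => i _; rewrite !divr_ge0// ltW.
(* The induction hypothesis at order [m.+1] covers [Num.min t S]; the rest of the way to [t] is the
   new move. *)
have s0 : 0 <= Num.min t S by rewrite le_min t0.
have h0 : 0 <= t - Num.min t S by rewrite subr_ge0 ge_min lexx.
have hr : e * (t - Num.min t S) * (M m.+1 / M m) <= 1.
  case: (leP t S) => [|_]; first by rewrite subrr mulr0 mul0r.
  have -> : 1 = e * ((M m / M m.+1) / e) * (M m.+1 / M m).
    by field; rewrite !gt_eqF.
  by rewrite ler_pM2r ?divr_gt0// ler_pM2l// lerBlDr.
have B1 : 1 <= e ^- m.+1 * e ^+ m.+1 by rewrite mulVf ?gt_eqF ?exprn_gt0.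
have sS : Num.min t S <= S by rewrite ge_min lexx orbT.
have := @bang_step m (e ^- m.+1) _ _ s0 h0 B1 (IH m.+1 _ s0 sS) n (leqW nm).
rewrite addrC subrK => /le_trans; apply.
have eE : expR (e * (t - Num.min t S) * (M m.+1 / M m)) <= e by rewrite ler_expR.
have -> : e ^- m * e ^+ n * M n = e ^- m.+1 * e ^+ n * M n * e.
  by rewrite exprS; field; rewrite !gt_eqF ?exprn_gt0.
by rewrite ler_wpM2l// !(mulr_ge0, invr_ge0, exprn_ge0)// ltW.
Qed.

(* Bang's theorem: no analyticity of the F n is involved, the divergence of the
   series is what allows the descent to reach an arbitrary t. *)
Theorem bang_vanishing :
  (forall A m, exists d, A <= \sum_(m <= i < m + d) M i / M i.+1) ->
  forall t, 0 <= t -> F 0 t = 0.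
Proof.
move=> Mdiv t t0; apply/normr0_eq0/eqP; rewrite eq_le normr_ge0 andbT.
apply/ler_addgt0Pl => eps eps0; rewrite addr0.
have : e ^- m @[m --> \oo] --> (0 : R).
  under eq_fun do rewrite -exprVn.
  by apply: cvg_expr; rewrite ger0_norm ?invr_ge0 ?ltW// invf_lt1// /e expR_gt1.
move=> /cvgrPdist_lt /(_ (eps / M 0%N)); rewrite divr_gt0// => /(_ isT) [m _ /(_ m)].
have em0 : 0 <= e ^- m by rewrite invr_ge0 exprn_ge0.
rewrite /= leqnn sub0r normrN (ger0_norm em0) => /(_ isT) em.
(* The order [m] is fixed first, by the accuracy wanted; the series still diverges from [m] on, so
   [t] can be reached. *)
have [d Hd] := Mdiv (e * t) m.
have td : t <= \sum_(m <= i < m + d) (M i / M i.+1) / e.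
  by rewrite -mulr_suml ler_pdivlMr// mulrC.
apply: le_trans (bang_descent t0 td (leq0n m)) _.
by rewrite expr0 mulr1 -ler_pdivlMr// ltW.
Qed.

End BangLemma.

(** * Carleman's inequality for geometric means *)

Section CarlemanInequality.
Variable R : realType.

Lemma expr_div_fact_le_expR n (x : R) : 0 <= x -> x ^+ n / n`!%:R <= expR x.
Proof.
case: n => [|n] x0; first by rewrite fact0 divr1 expr0 -expR0 ler_expR.
by apply: le_trans (expR_ge1Dxn n x0); rewrite lerDr.
Qed.

(** AM-GM for the numbers [i.+1%:R * a i]; the product of the weights is a factorial, and
    [N ^ N / N!] is at most [exp N] for [N = n.+1]. *)
Lemma geometric_mean_le (a : nat -> R) n : (forall i, 0 < a i) ->
  (\prod_(i < n.+1) a i) `^ (n.+1%:R^-1)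
    <= expR 1 * (\sum_(i < n.+1) i.+1%:R * a i) / n.+1%:R ^+ 2.
Proof.
move=> a0; set S := \sum_(i < _) _.
have S0 : 0 <= S by apply: sumr_ge0 => i _; rewrite mulr_ge0// ltW.
have n0 : (n.+1%:R : R) != 0 by rewrite pnatr_eq0.
have rhs0 : 0 <= expR 1 * S / n.+1%:R ^+ 2.
  by rewrite !mulr_ge0 ?expR_ge0.
have -> : expR 1 * S / n.+1%:R ^+ 2 =
    ((expR 1 * S / n.+1%:R ^+ 2) ^+ n.+1) `^ (n.+1%:R^-1).
  by rewrite -powR_mulrn// -powRrM divff// powRr1.
apply: ge0_ler_powR; rewrite ?nnegrE ?invr_ge0 ?exprn_ge0//.
  by apply: prodr_ge0 => i _; exact: ltW.
have fact0 : 0 < ((n.+1)`!%:R : R) by rewrite ltr0n fact_gt0.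
have : \prod_(i < n.+1) (i.+1%:R * a i) <= (S / n.+1%:R) ^+ n.+1.
  have [] := @leif_AGM R 'I_n.+1 predT (fun i => i.+1%:R * a i).
    by move=> i _; rewrite mulr_ge0// ltW.
  by rewrite card_ord.
rewrite big_split/=.
have -> : \prod_(i < n.+1) (i.+1%:R : R) = (n.+1)`!%:R.
  by rewrite -natr_prod fact_prod big_add1/= big_mkord.
rewrite -ler_pdivlMl// => /le_trans; apply.
have := @expr_div_fact_le_expR n.+1 n.+1%:R (ler0n _ _).
rewrite -[in leRHS](mulr1 n.+1%:R) expRM_natl => H.
have -> : expR 1 * S / n.+1%:R ^+ 2 = (expR 1 / n.+1%:R) * (S / n.+1%:R) :> R.
  by field.
rewrite [leRHS]exprMn ler_wpM2r ?exprn_ge0 ?divr_ge0//.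
rewrite expr_div_n ler_pdivlMr ?exprn_gt0//.
by apply: le_trans H; rewrite mulrC.
Qed.

(* The tail bound [1 / (N+1)^2 + 1 / (N+3/2) <= 1 / (N+1/2)] makes the second
   summand on the left a potential absorbing all later terms. *)
Lemma hardy_sum_le (a : nat -> R) N : (forall i, 0 < a i) ->
  \sum_(n < N) (\sum_(i < n.+1) i.+1%:R * a i) / n.+1%:R ^+ 2
    + (\sum_(i < N) i.+1%:R * a i) / (N%:R + 2^-1) <= 2 * \sum_(i < N) a i.
Proof.
move=> a0; elim: N => [|N IH]; first by rewrite !big_ord0 mul0r addr0 mulr0.
rewrite !(big_ord_recr N)/= mulrDr; set S := (\sum_(i < N) i.+1%:R * a i) in IH *.
have S0 : 0 <= S by apply: sumr_ge0 => i _; rewrite mulr_ge0// ltW.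
set T := \sum_(n < N) _ in IH *.
rewrite -lerBrDr in IH.
rewrite -addrA; apply: le_trans (lerD IH (lexx _)) _.
rewrite -addrA lerD2l -(natr1 N); move: (N%:R : R) (ler0n R N) (a N) (a0 N) => x x0 y y0.
have -> : - (S / (x + 2^-1)) + ((S + (x + 1) * y) / (x + 1) ^+ 2 +
   (S + (x + 1) * y) / (x + 1 + 2^-1)) =
   - (S * (4^-1 / ((x + 2^-1) * (x + 1) ^+ 2 * (x + 1 + 2^-1))))
   + y * ((x + 1)^-1 + (x + 1) / (x + 1 + 2^-1)).
  by field; rewrite !gt_eqF//; lra.
rewrite -[leRHS]add0r lerD// ?oppr_le0.
  by rewrite mulr_ge0// divr_ge0// !mulr_ge0 ?exprn_ge0//; lra.
rewrite mulrC ler_pM2r//.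
apply: (@le_trans _ _ (1 + 1)); last by lra.
apply: lerD.
  by rewrite invf_le1; lra.
rewrite ler_pdivrMr; lra.
Qed.

Theorem carleman_inequality (a : nat -> R) N : (forall i, 0 < a i) ->
  \sum_(n < N) (\prod_(i < n.+1) a i) `^ (n.+1%:R^-1)
    <= 2 * expR 1 * \sum_(i < N) a i.
Proof.
move=> a0.
apply: (@le_trans _ _ (\sum_(n < N)
    expR 1 * ((\sum_(i < n.+1) i.+1%:R * a i) / n.+1%:R ^+ 2))).
  by apply: ler_sum => n _; rewrite mulrA; exact: geometric_mean_le.
have -> x : 2 * expR 1 * x = expR 1 * (2 * x) :> R by ring.
rewrite -mulr_sumr ler_pM2l ?expR_gt0//.
apply: le_trans (hardy_sum_le N a0); rewrite lerDl divr_ge0//.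
by apply: sumr_ge0 => i _; rewrite mulr_ge0// ltW.
Qed.

(** The products of the ratios [a i] telescope to [(M n)^-1], so the geometric mean of the first
    [2 * k] of them is the term of index [k] in the hypothesis, and Carleman's inequality
    applies. *)
Lemma ratio_sum_unbounded (M : nat -> R) : (forall n, 0 < M n) -> M 0%N = 1 ->
  (forall A, exists K, A <= \sum_(1 <= k < K) M (2 * k)%N `^ (- ((2 * k)%:R^-1))) ->
  forall A m, exists d, A <= \sum_(m <= i < m + d) M i / M i.+1.
Proof.
move=> M0 M01 Mdiv A m; pose a i := M i / M i.+1.
have a0 i : 0 < a i by rewrite divr_gt0.
have prod_a n : \prod_(i < n) a i = (M n)^-1.
  elim: n => [|n IH]; first by rewrite big_ord0 M01 invr1.
  by rewrite big_ord_recr/= IH /a mulrA mulVf ?mul1r// gt_eqF.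
have [K HK] := Mdiv (2 * expR 1 * (A + \sum_(0 <= i < m) a i)).
exists (2 * K)%N.
rewrite -(lerD2l (\sum_(0 <= i < m) a i)) -big_cat_nat ?leq_addr//= addrC.
have e0 : 0 < 2 * expR 1 :> R by rewrite mulr_gt0// expR_gt0.
rewrite -(ler_pM2l e0); apply: (le_trans HK).
apply: (@le_trans _ _ (2 * expR 1 * \sum_(i < 2 * K) a i)); last first.
  rewrite ler_pM2l// addnC (big_cat_nat (n := 2 * K))//= ?leq_addr//.
  by rewrite big_mkord lerDl; apply: sumr_ge0 => i _; exact: ltW.
apply: le_trans (carleman_inequality (2 * K) a0).
(* One more term, so that the indices [k <= K] match the geometric means of the first [n <= 2 * K]
   ratios; those with [n] odd are dropped. *)
apply: (@le_trans _ _ (\sum_(1 <= k < K.+1) M (2 * k)%N `^ (- ((2 * k)%:R^-1)))).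
  case: K {HK} => [|K]; first by rewrite !big_geq.
  by rewrite [leRHS]big_nat_recr//= lerDl powR_ge0.
elim: K {HK} => [|K IH]; first by rewrite big_geq// muln0 big_ord0.
rewrite big_nat_recr//= mulnS.
rewrite (big_ord_recr (2 * K).+1) (big_ord_recr (2 * K))/= -[leRHS]addrA lerD//.
rewrite -[leLHS]add0r lerD ?powR_ge0// -add2n.
have invpow x p : 0 < x -> x^-1 `^ p = x `^ (- p) :> R.
  by move=> x0; rewrite -powR_inv1 ?ltW// -powRrM mulN1r.
by rewrite prod_a invpow.
Qed.

End CarlemanInequality.

(** * The cosine transform of a nonnegative variable with finite moments *)

Section CosineTransform.
Context d (T : measurableType d) (R : realType) (mu : probability T R).
Variable X : T -> R.
Hypothesis mX : measurable_fun setT X.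
Hypothesis X_ge0 : forall x, 0 <= X x.
Hypothesis X_moments : forall n, mu.-integrable setT (EFin \o (fun x => X x ^+ n)).

Definition cosine_derivative (n : nat) (t : R) : R :=
  (\int[mu]_x (X x ^+ n * cosn n (t * X x)))%R.

Definition abs_moment (n : nat) : R := (\int[mu]_x (X x ^+ n))%R.

Lemma measurable_cosine_derivative n t :
  measurable_fun setT (fun x => X x ^+ n * cosn n (t * X x)).
Proof.
apply: measurable_funM; first exact: measurable_funX.
apply: (measurableT_comp (measurable_cosn n)).
exact: measurable_funM.
Qed.

Lemma integrable_cosine_derivative n t :
  mu.-integrable setT (EFin \o (fun x => X x ^+ n * cosn n (t * X x))).
Proof.
apply: (le_integrable _ _ _ (X_moments n)) => //.
  by apply/measurable_EFinP; exact: measurable_cosine_derivative.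
move=> x _ /=; rewrite lee_fin normrM -[leRHS]mulr1 ler_wpM2l//.
exact: cosn_max.
Qed.

(** Both claims are proved together: linearity at the inductive step needs the integrability of the
    partial combination. *)
Lemma Rintegral_lincomb k (f : T -> R) (g : nat -> T -> R) (c : nat -> R) :
  mu.-integrable setT (EFin \o f) ->
  (forall j, mu.-integrable setT (EFin \o g j)) ->
  mu.-integrable setT (EFin \o (fun x => f x - \sum_(j < k) g j x * c j)) /\
  (\int[mu]_x (f x - \sum_(j < k) g j x * c j) =
    \int[mu]_x f x - \sum_(j < k) (\int[mu]_x g j x) * c j)%R.
Proof.
move=> fi gi; elim: k => [|k [IHi IH]].
  rewrite big_ord0 subr0; split.
    by apply: eq_integrable fi => // x _ /=; rewrite big_ord0 subr0.
  by apply: eq_Rintegral => x _; rewrite big_ord0 subr0.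
have gc : mu.-integrable setT (EFin \o (fun x => g k x * c k)).
  have := integrableZr (@measurableT _ T) (c k) (gi k).
  by apply: eq_integrable => // x _ /=.
have E x : f x - \sum_(j < k.+1) g j x * c j =
    (f x - \sum_(j < k) g j x * c j) - g k x * c k.
  by rewrite big_ord_recr/= opprD addrA.
split.
  have := integrableB (@measurableT _ T) IHi gc.
  by apply: eq_integrable => // x _ /=; rewrite E EFinB.
under eq_Rintegral do rewrite E.
by rewrite RintegralB// IH RintegralZr// big_ord_recr/= opprD addrA.
Qed.

(** Integrate [cosn_taylor], taken at [t * X x] with increment [h * X x] and multiplied by
    [X x ^+ n]. *)
Lemma cosine_derivative_taylor n k t h : 0 <= h ->
  `|cosine_derivative n (t + h)
    - \sum_(j < k) cosine_derivative (n + j) t * (h ^+ j / j`!%:R)|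
    <= abs_moment (n + k) * (h ^+ k / k`!%:R).
Proof.
move=> h0.
have [i E] := @Rintegral_lincomb k _ (fun j x => X x ^+ (n + j) * cosn (n + j) (t * X x))
  (fun j => h ^+ j / j`!%:R) (integrable_cosine_derivative n (t + h))
  (fun j => integrable_cosine_derivative (n + j) t).
rewrite /cosine_derivative -E; apply: le_trans (le_normr_Rintegral _ i) _ => //.
rewrite /abs_moment -RintegralZr//; apply: le_Rintegral => //.
- exact: (integrable_norm i).
- have := integrableZr (@measurableT _ T) (h ^+ k / k`!%:R) (X_moments (n + k)).
  by apply: eq_integrable => // x _ /=.
move=> x _.
have -> : X x ^+ n * cosn n ((t + h) * X x) -
    \sum_(j < k) X x ^+ (n + j) * cosn (n + j) (t * X x) * (h ^+ j / j`!%:R) =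
    X x ^+ n * (cosn n (t * X x + h * X x) -
    \sum_(j < k) cosn (n + j) (t * X x) * ((h * X x) ^+ j / j`!%:R)).
  rewrite mulrBr mulrDl; congr (_ - _); rewrite mulr_sumr; apply: eq_bigr => j _.
  by rewrite exprD exprMn; ring.
rewrite normrM ger0_norm ?exprn_ge0// exprD -mulrA ler_wpM2l ?exprn_ge0//.
apply: le_trans (cosn_taylor _ _ _ _) _; first by rewrite mulr_ge0.
by rewrite exprMn mulrA [X in X / _]mulrC.
Qed.

Lemma cosine_derivative_odd_at0 n : odd n -> cosine_derivative n 0 = 0.
Proof.
move=> no; rewrite /cosine_derivative.
under eq_Rintegral do rewrite mul0r cosn_odd_at0// mulr0.
by rewrite Rintegral_cst// mul0r.
Qed.

Lemma cosine_derivative_even_at0 n : ~~ odd n ->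
  cosine_derivative n 0 = abs_moment n * cosn n 0.
Proof.
move=> no; rewrite /cosine_derivative /abs_moment -RintegralZr//.
by under eq_Rintegral do rewrite mul0r.
Qed.

Lemma abs_moment_ge0 n : 0 <= abs_moment n.
Proof. by apply: Rintegral_ge0 => x _; rewrite exprn_ge0. Qed.

Lemma abs_moment0 : abs_moment 0 = 1.
Proof.
rewrite /abs_moment; under eq_Rintegral do rewrite expr0.
rewrite Rintegral_cst// mul1r.
by rewrite -[RHS]/(fine 1%E); congr fine; exact: probability_setT.
Qed.

(** The expression is the mean of [X ^+ n * (X - c) ^+ 2]. Being linear in the moments, the
    inequality passes to the average of two laws, where a suitable [c] yields log-convexity. *)
Lemma abs_moment_quadratic n c :
  0 <= abs_moment n.+2 - 2 * c * abs_moment n.+1 + c ^+ 2 * abs_moment n.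
Proof.
have iZ m (r : R) : mu.-integrable setT (EFin \o (fun x => r * X x ^+ m)).
  have := integrableZl (@measurableT _ T) r (X_moments m).
  by apply: eq_integrable => // x _ /=.
rewrite /abs_moment -!RintegralZl// -RintegralB// -RintegralD//.
  apply: Rintegral_ge0 => x _.
  have -> : X x ^+ n.+2 - 2 * c * X x ^+ n.+1 + c ^+ 2 * X x ^+ n =
    X x ^+ n * (X x - c) ^+ 2 by rewrite !exprS; ring.
  by rewrite mulr_ge0 ?sqr_ge0// exprn_ge0.
have := integrableB (@measurableT _ T) (X_moments n.+2) (iZ n.+1 (2 * c)).
by apply: eq_integrable => // x _ /=; rewrite EFinB.
Qed.

End CosineTransform.

(** * Equality of the cosine transforms under Carleman's condition *)

Section StieltjesCarleman.
Context d (T : measurableType d) (R : realType) (mu nu : probability T R).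
Variable X : T -> R.
Hypothesis mX : measurable_fun setT X.
Hypothesis X_ge0 : forall x, 0 <= X x.
Hypothesis X_mu : forall n, mu.-integrable setT (EFin \o (fun x => X x ^+ n)).
Hypothesis X_nu : forall n, nu.-integrable setT (EFin \o (fun x => X x ^+ n)).
Hypothesis even_gt0 : forall k, 0 < abs_moment mu X (2 * k).
Hypothesis even_eq : forall k, abs_moment nu X (2 * k) = abs_moment mu X (2 * k).
Hypothesis even_carleman : forall A : R, exists K, A <=
  \sum_(1 <= k < K) abs_moment mu X (2 * k) `^ (- ((2 * k)%:R^-1)).

(* The odd moments of X under mu and nu may differ. *)
Let M n := (abs_moment mu X n + abs_moment nu X n) / 2.
Let F n t := (cosine_derivative mu X n t - cosine_derivative nu X n t) / 2.

Lemma Rintegral_cos_eq (t : R) :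
  (\int[mu]_x cos (t * X x) = \int[nu]_x cos (t * X x))%R.
Proof.
wlog t0 : t / 0 <= t.
  move=> H; have [/H//|/ltW t0] := leP 0 t.
  have := H (- t); rewrite oppr_ge0 => /(_ t0).
  by under eq_Rintegral do rewrite mulNr cosN; under [RHS]eq_Rintegral do
    rewrite mulNr cosN.
have Meven k : M (2 * k)%N = abs_moment mu X (2 * k).
  by rewrite /M even_eq; field.
have M_ge0 n : 0 <= M n by rewrite divr_ge0// addr_ge0// abs_moment_ge0.
have Mquad n c : 0 <= M n.+2 - 2 * c * M n.+1 + c ^+ 2 * M n.
  have := abs_moment_quadratic X_ge0 X_mu n c.
  have := abs_moment_quadratic X_ge0 X_nu n c.
  by rewrite /M; lra.
(* If [M] vanished at an odd index, [Mquad] there would be affine in [c] with negative slope, hence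
   false for large [c]. *)
have M_gt0 n : 0 < M n.
  rewrite -(odd_double_half n); case: odd; last first.
    by rewrite add0n -mul2n Meven.
  rewrite add1n -mul2n lt0r M_ge0 andbT; apply/negP => /eqP M0.
  have S2 : ((2 * n./2).+2 = 2 * n./2.+1)%N by rewrite mulnS.
  have := Mquad (2 * n./2).+1 ((M (2 * n./2).+3 + 1) / M (2 * n./2).+2).
  rewrite M0 mulr0 addr0 -mulrA divfK; last by rewrite S2 Meven gt_eqF.
  by have := M_ge0 (2 * n./2).+3; lra.
have M_lc n : M n.+1 ^+ 2 <= M n * M n.+2.
  have := Mquad n (M n.+1 / M n).
  have -> : M n.+2 - 2 * (M n.+1 / M n) * M n.+1 + (M n.+1 / M n) ^+ 2 * M n =
      M n.+2 - M n.+1 ^+ 2 / M n.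
    by field; rewrite gt_eqF.
  by rewrite subr_ge0 ler_pdivrMr// mulrC.
have F_taylor n k u h : 0 <= u -> 0 <= h ->
  `|F n (u + h) - \sum_(j < k) F (n + j)%N u * (h ^+ j / j`!%:R)|
    <= M (n + k)%N * (h ^+ k / k`!%:R).
  move=> _ h0.
  have := cosine_derivative_taylor mX X_ge0 X_mu n k u h0.
  have := cosine_derivative_taylor mX X_ge0 X_nu n k u h0.
  rewrite /F /M.
  have -> : \sum_(j < k) (cosine_derivative mu X (n + j) u -
       cosine_derivative nu X (n + j) u) / 2 * (h ^+ j / j`!%:R) =
     (\sum_(j < k) cosine_derivative mu X (n + j) u * (h ^+ j / j`!%:R) -
      \sum_(j < k) cosine_derivative nu X (n + j) u * (h ^+ j / j`!%:R)) / 2.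
    by rewrite -sumrB mulr_suml; apply: eq_bigr => j _; ring.
  rewrite !ler_norml => /andP[? ?] /andP[? ?]; apply/andP; split; lra.
(* At 0 the odd derivatives of the cosine vanish, so only even moments enter, and these agree. *)
have F_at0 n : F n 0 = 0.
  rewrite /F; have [no|ne] := boolP (odd n).
    by rewrite !cosine_derivative_odd_at0// subrr mul0r.
  rewrite !cosine_derivative_even_at0//.
  by rewrite -(odd_double_half n) (negbTE ne) add0n -mul2n even_eq subrr mul0r.
have M01 : M 0%N = 1 by rewrite /M !abs_moment0 -mulr2n divff.
have Mdiv := ratio_sum_unbounded M_gt0 M01.
have := bang_vanishing M_gt0 M_lc F_taylor F_at0 (Mdiv _) t0.
have -> : F 0%N t = (\int[mu]_x cos (t * X x) - \int[nu]_x cos (t * X x)) / 2.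
  rewrite /F /cosine_derivative; congr ((_ - _) / _);
  by apply: eq_Rintegral => x _; rewrite expr0 mul1r cosn0.
move=> H; apply/eqP; rewrite -subr_eq0.
have /H/eqP : forall A, exists K : nat, A <=
    \sum_(1 <= k < K) M (2 * k)%N `^ (- (2 * k)%:R^-1).
  move=> A; have [K HK] := even_carleman A; exists K.
  by under eq_bigr do rewrite Meven.
by rewrite mulf_eq0 invr_eq0 pnatr_eq0 orbF.
Qed.

End StieltjesCarleman.

(** * Gaussians and indicators as pointwise limits *)

Section PointwiseLimits.
Variable R : realType.

Lemma ler_dist_expr (a b : R) n : `|a| <= 1 -> `|b| <= 1 ->
  `|a ^+ n - b ^+ n| <= n%:R * `|a - b|.
Proof.
move=> a1 b1; elim: n => [|n IH]; first by rewrite subrr normr0 mul0r.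
have -> : a ^+ n.+1 - b ^+ n.+1 = a * (a ^+ n - b ^+ n) + (a - b) * b ^+ n.
  by rewrite !exprS; ring.
rewrite (le_trans (ler_normD _ _))// !normrM -natr1 mulrDl mul1r lerD//.
  by rewrite (le_trans _ IH)// ler_piMl.
by rewrite ler_piMr// normrX exprn_ile1.
Qed.

(** Both functions are close to [1 - u ^+ 2 / 2]: the cosine within [u ^+ 4 / 24], the Gaussian
    within [u ^+ 4 / 4]. *)
Lemma cos_Gauss_dist (u : R) : 0 <= u -> `|cos u - expR (- (u ^+ 2 / 2))| <= u ^+ 4.
Proof.
move=> u0.
have := @cosn_taylor R 4 0 0 u u0.
rewrite !big_ord_recr/= big_ord0 add0r !cosn0 cosnS cosnSS cosnSS cosnS cosn0.
rewrite !mulr0n !addr0 !add0r cos0 sin0 ?oppr0 !expr0.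
have -> : (0`! = 1)%N by []. have -> : (2`! = 2)%N by []. have -> : (4`! = 24)%N by [].
rewrite !mul0r addr0 mul1r => C.
set v := u ^+ 2 / 2.
have v0 : 0 <= v by rewrite divr_ge0// sqr_ge0.
have E1 : 1 - v <= expR (- v) by exact: expR_ge1Dx.
have E2 : expR (- v) <= 1 - v + v ^+ 2.
  rewrite expRN; apply: (@le_trans _ _ (1 + v)^-1).
    by rewrite lef_pV2 ?posrE ?expR_gt0// ?expR_ge1Dx//; lra.
  rewrite -[leLHS]mul1r ler_pdivrMr; last by lra.
  have -> : (1 - v + v ^+ 2) * (1 + v) = 1 + v ^+ 3 by ring.
  by rewrite lerDl exprn_ge0.
have v2 : v ^+ 2 = u ^+ 4 / 4 by rewrite /v; field.
rewrite v2 in E2.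
have u4 : 0 <= u ^+ 4 by exact: exprn_ge0.
move: C; rewrite !ler_norml => /andP[C1 C2]; apply/andP.
have vE : u ^+ 2 / 2 = v by [].
by split; lra.
Qed.

(** The limit is the power of exponent [n.+1 ^ 2] of the Gaussian at [y / n.+1%:R], so
    [ler_dist_expr] leaves an error of order [n.+1 ^ 2 * (y / n.+1) ^ 4]. *)
Lemma cvg_cos_Gauss (y : R) : 0 <= y ->
  cos (y / n.+1%:R) ^+ (n.+1 ^ 2) @[n --> \oo] --> expR (- (y ^+ 2 / 2)).
Proof.
move=> y0; apply/cvgrPdist_le => eps eps0.
near=> n.
have n0 : 0 < n.+1%:R :> R by rewrite ltr0n.
have -> : expR (- (y ^+ 2 / 2)) = expR (- ((y / n.+1%:R) ^+ 2 / 2)) ^+ (n.+1 ^ 2).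
  rewrite -expRM_natl natrX; congr expR.
  by field; rewrite gt_eqF.
rewrite distrC.
apply: le_trans (ler_dist_expr _ _ _) _.
- exact: cos_max.
- by rewrite ger0_norm ?expR_ge0// expR_le1 oppr_le0 divr_ge0// sqr_ge0.
apply: (@le_trans _ _ ((n.+1 ^ 2)%:R * (y / n.+1%:R) ^+ 4)).
  by rewrite ler_wpM2l// cos_Gauss_dist// divr_ge0// ltW.
have -> : (n.+1 ^ 2)%:R * (y / n.+1%:R) ^+ 4 = y ^+ 4 / n.+1%:R / n.+1%:R.
  by rewrite natrX; field; rewrite gt_eqF.
apply: (@le_trans _ _ (y ^+ 4 / n.+1%:R)).
  by rewrite ler_pdivrMr// ler_peMr ?ler1n// divr_ge0// exprn_ge0.
rewrite ler_pdivrMr// mulrC -ler_pdivrMr//.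
apply: (@le_trans _ _ n%:R); last by rewrite ler_nat.
near: n; exact: nbhs_infty_ger.
Unshelve. all: by end_near. Qed.

(* The exponent is of order n * exp (n c) and not exp (n c), so that the boundary
   case y = c also has limit 0. *)
Definition tail_exponent (c : R) (n : nat) : nat :=
  ((Num.truncn (expR (n%:R * c))).+1 * n)%N.

(** Let [N] be the exponent. If [c < y], the distance to 1 is at most [N exp (- n y)], hence at most
    [2 n exp (- n (y - c))]. If [y <= c], then [N exp (- n y) >= n], and the power is at most
    [exp (- N exp (- n y))]. *)
Lemma cvg_tail_indic (c y : R) : 0 <= c -> 0 <= y ->
  (1 - expR (- (n%:R * y))) ^+ tail_exponent c n @[n --> \oo]
    --> (if c < y then 1 else 0 : R).
Proof.
move=> c0 y0.
have p1 n : expR (- (n%:R * y)) <= 1 by rewrite expR_le1 oppr_le0 mulr_ge0.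
have q0 n : 0 <= 1 - expR (- (n%:R * y)) by rewrite subr_ge0.
have q1 n : 1 - expR (- (n%:R * y)) <= 1 by rewrite lerBlDr lerDl expR_ge0.
case: ifPn => [cy|]; last rewrite -leNgt => yc.
  have dpos : 0 < y - c by rewrite subr_gt0.
  apply/cvgrPdist_le => eps eps0; near=> n.
  have n0 : 0 < n%:R :> R.
    by rewrite ltr0n; near: n; exact: nbhs_infty_gt.
  rewrite -[X in X - _](expr1n _ (tail_exponent c n)).
  apply: le_trans (ler_dist_expr _ _ _) _; [by rewrite normr1|by rewrite ger0_norm|].
  have -> : 1 - (1 - expR (- (n%:R * y))) = expR (- (n%:R * y)) by ring.
  rewrite ger0_norm ?expR_ge0//.
  have Nle : (tail_exponent c n)%:R <= 2 * expR (n%:R * c) * n%:R :> R.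
    rewrite natrM ler_wpM2r// -natr1.
    have : (Num.truncn (expR (n%:R * c)))%:R <= expR (n%:R * c).
      by rewrite truncn_le expR_ge0.
    have : 1 <= expR (n%:R * c) by rewrite -[leLHS]expR0 ler_expR mulr_ge0.
    by lra.
  apply: (@le_trans _ _ (2 * n%:R * expR (- (n%:R * (y - c))))).
    apply: (@le_trans _ _ (2 * expR (n%:R * c) * n%:R * expR (- (n%:R * y)))).
      by rewrite ler_wpM2r// expR_ge0.
    have -> : - (n%:R * (y - c)) = n%:R * c + - (n%:R * y) by ring.
    by rewrite expRD le_eqVlt; apply/orP; left; apply/eqP; ring.
  (* The quadratic term of the exponential suffices to beat the factor [n]. *)
  have ex : (n%:R * (y - c)) ^+ 2 / 2 <= expR (n%:R * (y - c)).
    apply: le_trans (expR_ge1Dxn 1 _); last by rewrite mulr_ge0// ltW.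
    by rewrite lerDr.
  rewrite expRN ler_pdivrMr ?expR_gt0//.
  apply: le_trans (ler_wpM2l (ltW eps0) ex).
  have -> : eps * ((n%:R * (y - c)) ^+ 2 / 2) =
     n%:R * (n%:R * (eps * (y - c) ^+ 2 / 2)) by ring.
  rewrite mulrC ler_pM2l// -ler_pdivrMr; last first.
    by rewrite divr_gt0// mulr_gt0// exprn_gt0.
  by near: n; exact: nbhs_infty_ger.
apply/cvgrPdist_le => eps eps0; near=> n.
rewrite sub0r normrN ger0_norm ?exprn_ge0//.
have Np : n%:R <= (tail_exponent c n)%:R * expR (- (n%:R * y)).
  rewrite natrM mulrAC ler_peMl//.
  apply: (@le_trans _ _ (expR (n%:R * c) * expR (- (n%:R * y)))).
    by rewrite -expRD -expR0 ler_expR -mulrBr mulr_ge0// subr_ge0.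
  by rewrite ler_wpM2r ?expR_ge0// ltW// truncnS_gt.
apply: (@le_trans _ _ (expR (- expR (- (n%:R * y))) ^+ tail_exponent c n)).
  by rewrite lerXn2r ?nnegrE ?expR_ge0// expR_ge1Dx.
have H : n%:R <= expR ((tail_exponent c n)%:R * expR (- (n%:R * y))).
  by apply: le_trans Np _; apply: le_trans (expR_ge1Dx _); rewrite lerDr.
rewrite -expRM_natl mulrN; move: ((tail_exponent c n)%:R * _) H => z H.
rewrite expRN -[leLHS]mul1r ler_pdivrMr ?expR_gt0//.
apply: le_trans (ler_wpM2l (ltW eps0) H).
by rewrite mulrC -ler_pdivrMr//; near: n; exact: nbhs_infty_ger.
Unshelve. all: by end_near. Qed.

End PointwiseLimits.

(** * Bounded convergence for probability measures *)

Section BoundedLimits.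
Context d (T : measurableType d) (R : realType).

Lemma bounded_integrable (mu : probability T R) (f : T -> R) (B : R) :
  measurable_fun setT f -> (forall x, `|f x| <= B) ->
  mu.-integrable setT (EFin \o f).
Proof.
move=> mf fB; apply: (@le_integrable _ _ _ _ _ _ _ (EFin \o cst B)) => //.
- exact/measurable_EFinP.
- by move=> x _ /=; rewrite lee_fin (le_trans (fB x))// ler_norm.
- exact: finite_measure_integrable_cst.
Qed.

Lemma cvg_Rintegral_bounded (mu : probability T R) (f_ : nat -> T -> R) (f : T -> R) :
  (forall n, measurable_fun setT (f_ n)) -> measurable_fun setT f ->
  (forall n x, `|f_ n x| <= 1) ->
  (forall x, f_ n x @[n --> \oo] --> f x) ->
  (\int[mu]_x f_ n x)%R @[n --> \oo] --> (\int[mu]_x f x)%R.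
Proof.
move=> mf_ mf f1 cf.
have [] := @dominated_convergence _ _ _ mu setT measurableT
  (fun n => EFin \o f_ n) (EFin \o f) (EFin \o cst 1).
- by move=> n; exact/measurable_EFinP.
- exact/measurable_EFinP.
- by apply: aeW => x _; apply: cvg_EFin; [exact: nearW | exact: cf].
- exact: finite_measure_integrable_cst.
- by apply: aeW => x n _ /=; rewrite lee_fin.
move=> fi _ cfi; apply: fine_cvg.
by rewrite /Rintegral fineK//; exact: integrable_fin_num.
Qed.

Lemma Rintegral_eq_lim (mu nu : probability T R) (f_ : nat -> T -> R) (f : T -> R) :
  (forall n, measurable_fun setT (f_ n)) -> measurable_fun setT f ->
  (forall n x, `|f_ n x| <= 1) ->
  (forall x, f_ n x @[n --> \oo] --> f x) ->
  (forall n, \int[mu]_x f_ n x = \int[nu]_x f_ n x)%R ->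
  (\int[mu]_x f x = \int[nu]_x f x)%R.
Proof.
move=> mf_ mf f1 cf E.
have cmu := @cvg_Rintegral_bounded mu _ _ mf_ mf f1 cf.
have := @cvg_Rintegral_bounded nu _ _ mf_ mf f1 cf.
under eq_fun do rewrite -E.
by move=> cnu; exact: (cvg_unique _ cmu cnu).
Qed.
End BoundedLimits.

(** * From cosine transforms to Gaussian means *)

Section CosineUniqueness.
Context d (T : measurableType d) (R : realType) (mu nu : probability T R).
Variable X : T -> R.
Hypothesis mX : measurable_fun setT X.
Hypothesis X_ge0 : forall x, 0 <= X x.
Hypothesis cos_eq : forall t,
  (\int[mu]_x cos (t * X x) = \int[nu]_x cos (t * X x))%R.

Lemma measurable_cosM t : measurable_fun setT (fun x => cos (t * X x)).
Proof.
apply: (measurableT_comp (continuous_measurable_fun (@continuous_cos R))).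
exact: measurable_funM.
Qed.

(** The free factor [cos (t * X x)] carries the induction: the product formula absorbs one
    [cos (s * X x)] into it, moving [t] to [t + s] and [t - s]. The case wanted is [t = 0]. *)
Lemma Rintegral_cosX_eq n s t :
  (\int[mu]_x (cos (s * X x) ^+ n * cos (t * X x)) =
   \int[nu]_x (cos (s * X x) ^+ n * cos (t * X x)))%R.
Proof.
elim: n t => [|n IH] t.
  under eq_Rintegral do rewrite expr0 mul1r.
  by under [RHS]eq_Rintegral do rewrite expr0 mul1r.
have mf u : measurable_fun setT (fun x => cos (s * X x) ^+ n * cos (u * X x)).
  apply: measurable_funM; last exact: measurable_cosM.
  exact: measurable_funX (measurable_cosM s).
have fi (la : probability T R) u :
    la.-integrable setT (EFin \o (fun x => cos (s * X x) ^+ n * cos (u * X x))).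
  apply: (@bounded_integrable _ _ _ _ _ 1) => // x.
  by rewrite normrM normrX mulr_ile1 ?exprn_ile1 ?exprn_ge0 ?cos_max.
have E x : cos (s * X x) ^+ n.+1 * cos (t * X x) =
    2^-1 * (cos (s * X x) ^+ n * cos ((t + s) * X x) +
           cos (s * X x) ^+ n * cos ((t - s) * X x)).
  by rewrite mulrDl mulrBl cosD cosB exprSr; field.
have step (la : probability T R) :
    (\int[la]_x (cos (s * X x) ^+ n.+1 * cos (t * X x)) =
     2^-1 * (\int[la]_x (cos (s * X x) ^+ n * cos ((t + s) * X x)) +
       \int[la]_x (cos (s * X x) ^+ n * cos ((t - s) * X x))))%R.
  under eq_Rintegral do rewrite E.
  rewrite RintegralZl//; first by rewrite RintegralD//; exact: fi.
  have := integrableD (@measurableT _ T) (fi la (t + s)) (fi la (t - s)).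
  by apply: eq_integrable => // x _ /=.
by rewrite !step !IH.
Qed.

Lemma Rintegral_Gauss_eq c : 0 <= c ->
  (\int[mu]_x expR (- (c * X x ^+ 2)) = \int[nu]_x expR (- (c * X x ^+ 2)))%R.
Proof.
move=> c0; pose s := Num.sqrt (2 * c).
have s0 : 0 <= s by exact: sqrtr_ge0.
have s2 : s ^+ 2 = 2 * c by rewrite sqr_sqrtr// mulr_ge0.
apply: (@Rintegral_eq_lim _ _ _ _ _
  (fun n x => cos (s * X x / n.+1%:R) ^+ (n.+1 ^ 2))).
- move=> n; apply: measurable_funX.
  under eq_fun do rewrite mulrAC.
  exact: measurable_cosM.
- apply: measurableT_comp => //; apply: measurableT_comp => //.
  by apply: measurable_funM => //; exact: measurable_funX.
- by move=> n x; rewrite normrX exprn_ile1// cos_max.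
- move=> x.
  have -> : c * X x ^+ 2 = (s * X x) ^+ 2 / 2 by rewrite exprMn s2; field.
  by apply: cvg_cos_Gauss; rewrite mulr_ge0.
move=> n; have := Rintegral_cosX_eq (n.+1 ^ 2) (s / n.+1%:R) 0.
under eq_Rintegral do rewrite mul0r cos0 mulr1 mulrAC.
by under [in RHS]eq_Rintegral do rewrite mul0r cos0 mulr1 mulrAC.
Qed.

End CosineUniqueness.

(** * From Laplace transforms to tails *)

Section LaplaceUniqueness.
Context d (T : measurableType d) (R : realType) (mu nu : probability T R).
Variable Y : T -> R.
Hypothesis mY : measurable_fun setT Y.
Hypothesis Y_ge0 : forall x, 0 <= Y x.
Hypothesis laplace_eq : forall c, 0 <= c ->
  (\int[mu]_x expR (- (c * Y x)) = \int[nu]_x expR (- (c * Y x)))%R.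

Let measurable_expM c : measurable_fun setT (fun x => expR (- (c * Y x))).
Proof.
apply: measurableT_comp => //; apply: measurableT_comp => //.
exact: measurable_funM.
Qed.

Let exp_le1 c x : 0 <= c -> expR (- (c * Y x)) <= 1.
Proof. by move=> c0; rewrite expR_le1 oppr_le0 mulr_ge0. Qed.

Let onem_exp_norm c x : 0 <= c -> `|1 - expR (- (c * Y x))| <= 1.
Proof.
by move=> c0; rewrite ger0_norm ?subr_ge0 ?exp_le1//.
Qed.

Let measurable_onem c n :
  measurable_fun setT (fun x => (1 - expR (- (c * Y x))) ^+ n).
Proof. by apply: measurable_funX; exact: measurable_funB. Qed.

(** The factor with [b] carries the induction: its product with [1 - expR (- (a * Y x))] is a
    difference of two such factors, at [b] and at [a + b]. The case wanted is [b = 0]. *)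
Lemma Rintegral_onem_expX_eq n a b : 0 <= a -> 0 <= b ->
  (\int[mu]_x ((1 - expR (- (a * Y x))) ^+ n * expR (- (b * Y x))) =
   \int[nu]_x ((1 - expR (- (a * Y x))) ^+ n * expR (- (b * Y x))))%R.
Proof.
move=> a0; elim: n b => [|n IH] b b0.
  under eq_Rintegral do rewrite expr0 mul1r.
  by under [RHS]eq_Rintegral do rewrite expr0 mul1r; exact: laplace_eq.
have fi (la : probability T R) u : 0 <= u -> la.-integrable setT
    (EFin \o (fun x => (1 - expR (- (a * Y x))) ^+ n * expR (- (u * Y x)))).
  move=> u0; apply: (@bounded_integrable _ _ _ _ _ 1) => [|x].
    exact: measurable_funM.
  rewrite normrM normrX mulr_ile1 ?exprn_ile1 ?exprn_ge0 ?onem_exp_norm//.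
  by rewrite ger0_norm ?expR_ge0 ?exp_le1.
have E x : (1 - expR (- (a * Y x))) ^+ n.+1 * expR (- (b * Y x)) =
    (1 - expR (- (a * Y x))) ^+ n * expR (- (b * Y x)) -
    (1 - expR (- (a * Y x))) ^+ n * expR (- ((a + b) * Y x)).
  have -> : - ((a + b) * Y x) = - (a * Y x) + - (b * Y x) by ring.
  by rewrite expRD exprSr; ring.
have ab0 : 0 <= a + b by rewrite addr_ge0.
have step (la : probability T R) :
    (\int[la]_x ((1 - expR (- (a * Y x))) ^+ n.+1 * expR (- (b * Y x))) =
     \int[la]_x ((1 - expR (- (a * Y x))) ^+ n * expR (- (b * Y x))) -
     \int[la]_x ((1 - expR (- (a * Y x))) ^+ n * expR (- ((a + b) * Y x))))%R.
  under eq_Rintegral do rewrite E.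
  by rewrite RintegralB//; exact: fi.
by rewrite !step !IH.
Qed.

Lemma tail_eq c : 0 <= c -> mu [set x | c < Y x] = nu [set x | c < Y x].
Proof.
move=> c0.
have mA : measurable [set x | c < Y x].
  have := mY measurableT (measurable_itv `]c, +oo[).
  rewrite setTI; congr measurable; apply/seteqP; split => x /=;
  by rewrite in_itv/= andbT.
have RE (la : probability T R) :
    (\int[la]_x (\1_[set x | c < Y x] x : R))%R = fine (la [set x | c < Y x]).
  by rewrite /Rintegral integral_indic// setIT.
have H : (\int[mu]_x (\1_[set x | c < Y x] x : R))%R =
    (\int[nu]_x (\1_[set x | c < Y x] x : R))%R.
  apply: (@Rintegral_eq_lim _ _ _ _ _
    (fun n x => (1 - expR (- (n%:R * Y x))) ^+ tail_exponent c n)).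
  - by move=> n; exact: measurable_onem.
  - exact: measurable_indic.
  - by move=> n x; rewrite normrX exprn_ile1// onem_exp_norm.
  - move=> x.
    have -> : \1_[set x | c < Y x] x = if c < Y x then 1 else 0 : R.
      by rewrite indicE; case: ifPn => cY; [rewrite mem_set | rewrite memNset//; exact/negP].
    exact: cvg_tail_indic.
  move=> n; have := Rintegral_onem_expX_eq (tail_exponent c n) (ler0n R n) (lexx 0).
  under eq_Rintegral do rewrite mul0r oppr0 expR0 mulr1.
  by under [in RHS]eq_Rintegral do rewrite mul0r oppr0 expR0 mulr1.
move: H; rewrite !RE => H.
by rewrite -[LHS]fineK ?fin_num_measure// H fineK// fin_num_measure.
Qed.

End LaplaceUniqueness.

(** The open rays are stable under intersection and generate the Borel sets; those starting at
    [- n%:R] exhaust the line. *)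
Lemma probability_eq_tails (R : realType) (mu nu : probability (measurableTypeR R) R) :
  (forall c : R, mu `]c, +oo[%classic = nu `]c, +oo[%classic) ->
  forall A : set R, measurable A -> mu A = nu A.
Proof.
move=> E A mA.
pose G := [set B : set R | exists x, B = `]x, +oo[%classic].
have U := @measure_unique _ R (measurableTypeR R) G (fun n => `]- n%:R, +oo[%classic).
apply: (U _ _ _ _ mu nu) => //.
- exact: RGenOInfty.measurableE.
- move=> _ _ [x ->] [y ->]; exists (Num.max x y).
  by apply/seteqP; split => z /=; rewrite !in_itv/= !andbT gt_max => /andP.
- by move=> n; exists (- n%:R).
- apply/seteqP; split => // x _; exists (Num.truncn (- x)).+1 => //=.
  by rewrite in_itv/= andbT ltrNl truncnS_gt.
- by move=> _ [x ->]; exact: E.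
- by move=> k; rewrite (le_lt_trans (probability_le1 _ _)) ?ltry.
Qed.

(** * Carleman's criterion for laws on the half line *)

Section StieltjesDeterminacy.
Variable R : realType.
Implicit Types mu nu : probability (measurableTypeR R) R.

Let measurable_sqrt : measurable_fun setT (@Num.sqrt R : measurableTypeR R -> R).
Proof. by apply: continuous_measurable_fun; exact: sqrt_continuous. Qed.

(** [Num.sqrt] is 0 on negative reals, and so are its positive powers. For [k = 0] the left side
    would be 1 there and the right side 0. *)
Let sqrtX_even (k : nat) : (0 < k)%N ->
  (fun x : R => Num.sqrt x ^+ (2 * k)) = (fun x : R => x ^+ k : R) \_ `[0, +oo[%classic.
Proof.
move=> k0; apply/funext => x; rewrite patchE; case: ifPn => [|].
  by rewrite inE/= in_itv/= andbT exprM => x0; rewrite sqr_sqrtr.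
move=> /negP; rewrite inE/= in_itv/= andbT => /negP; rewrite -ltNge => x0.
by rewrite ltr0_sqrtr// expr0n muln_eq0/= eqn0Ngt k0.
Qed.

Lemma even_moment_sqrt mu (m : nat -> R) (k : nat) :
  mu `[0, +oo[%classic = 1%E ->
  (forall k, \int[mu]_(x in `[0%R, +oo[%classic) (x ^+ k)%:E = (m k)%:E)%E ->
  (\int[mu]_x (Num.sqrt x ^+ (2 * k))%:E = (m k)%:E)%E.
Proof.
move=> mu1 mk; case: k => [|k].
  rewrite -mk; under eq_integral do rewrite muln0 expr0.
  under [RHS]eq_integral do rewrite expr0.
  by rewrite !integral_cst// !mul1e; apply: etrans (esym mu1); exact: probability_setT.
rewrite -mk [RHS]integral_mkcond; apply: eq_integral => x _.
by rewrite (congr1 (@^~ x) (sqrtX_even (ltn0Sn k))) restrict_EFin.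
Qed.

(** Even powers dominate all others: [s ^+ n <= 1 + s ^+ (2 * n)], because [(s ^+ n - 1) ^+ 2] is
    nonnegative. *)
Lemma integrable_sqrtX mu (m : nat -> R) (n : nat) :
  mu `[0, +oo[%classic = 1%E ->
  (forall k, \int[mu]_(x in `[0%R, +oo[%classic) (x ^+ k)%:E = (m k)%:E)%E ->
  mu.-integrable setT (EFin \o (fun x => Num.sqrt x ^+ n)).
Proof.
move=> mu1 mk.
have mX j : measurable_fun setT (EFin \o (fun x : measurableTypeR R => Num.sqrt x ^+ j)).
  by apply/measurable_EFinP; exact: measurable_funX.
have even k : mu.-integrable setT (EFin \o (fun x => Num.sqrt x ^+ (2 * k))).
  apply/integrableP; split => //.
  under eq_integral do rewrite gee0_abs ?lee_fin ?exprn_ge0 ?sqrtr_ge0//.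
  by rewrite (even_moment_sqrt k mu1 mk) ltry.
have one : mu.-integrable setT (EFin \o cst 1) by exact: finite_measure_integrable_cst.
apply: le_integrable (integrableD measurableT one (even n)) => //.
move=> x _ /=; rewrite lee_fin; set s := Num.sqrt x.
have s0 : 0 <= s by exact: sqrtr_ge0.
rewrite !ger0_norm ?addr_ge0 ?exprn_ge0//.
rewrite mulnC exprM; have := exprn_ge0 n s0; move: (s ^+ n) => y y0.
by have := sqr_ge0 (y - 1); lra.
Qed.

Theorem stieltjes_carleman mu nu (m : nat -> R) :
  mu `[0, +oo[%classic = 1%E -> nu `[0, +oo[%classic = 1%E ->
  (forall k, \int[mu]_(x in `[0%R, +oo[%classic) (x ^+ k)%:E = (m k)%:E)%E ->
  (forall k, \int[nu]_(x in `[0%R, +oo[%classic) (x ^+ k)%:E = (m k)%:E)%E ->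
  (forall k, 0 < m k) ->
  (forall A : R, exists K, A <= \sum_(1 <= k < K) m k `^ (- ((2 * k)%:R^-1))) ->
  forall A : set R, measurable A -> mu A = nu A.
Proof.
move=> mu1 nu1 mumk numk m0 mdiv.
pose X : measurableTypeR R -> R := @Num.sqrt R.
have X0 x : 0 <= X x by exact: sqrtr_ge0.
have muM k : abs_moment mu X (2 * k) = m k.
  by rewrite /abs_moment /Rintegral (even_moment_sqrt k mu1 mumk).
have nuM k : abs_moment nu X (2 * k) = m k.
  by rewrite /abs_moment /Rintegral (even_moment_sqrt k nu1 numk).
have cosE : forall t, (\int[mu]_x cos (t * X x) = \int[nu]_x cos (t * X x))%R.
  move=> t; apply: Rintegral_cos_eq => //.
  - by move=> n; exact: integrable_sqrtX mu1 mumk.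
  - by move=> n; exact: integrable_sqrtX nu1 numk.
  - by move=> k; rewrite muM.
  - by move=> k; rewrite muM nuM.
  - by move=> A; have [K HK] := mdiv A; exists K; under eq_bigr do rewrite muM.
have laplace c (c0 : 0 <= c) := Rintegral_Gauss_eq measurable_sqrt X0 cosE c0.
apply: probability_eq_tails => c.
have [c0|c0] := leP 0 c.
  have -> : `]c, +oo[%classic = [set x | c < X x ^+ 2].
    apply/seteqP; split => x /=; rewrite in_itv/= andbT.
      by move=> cx; rewrite sqr_sqrtr// ltW// (le_lt_trans c0).
    have [x0|x0] := leP 0 x; first by rewrite sqr_sqrtr.
    by rewrite /X ltr0_sqrtr// expr0n/= => /(le_lt_trans c0); rewrite ltxx.
  apply: (@tail_eq _ _ R mu nu (fun x => X x ^+ 2)) => // [|x].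
    exact: measurable_funX.
  by rewrite exprn_ge0.
(* For [c < 0] the ray contains the half line, so it has mass 1 under both laws. *)
have one (la : probability (measurableTypeR R) R) :
    la `[0, +oo[%classic = 1%E -> la `]c, +oo[%classic = 1%E.
  move=> la1; apply/eqP; rewrite eq_le probability_le1//= -la1.
  apply: le_measure; rewrite ?inE//.
  by move=> x /=; rewrite !in_itv/= !andbT; exact: lt_le_trans.
by rewrite !one.
Qed.

End StieltjesDeterminacy.

(** * The integral of the inverse square over a ray *)

Section InverseSquare.
Variable R : realType.
Local Notation leb := (@lebesgue_measure R).

Lemma powRN2 (x : R) : 0 <= x -> x `^ (- 2) = x ^- 2.
Proof. by move=> x0; rewrite (powR_invn 2 x0). Qed.

Lemma integral_powRN2 (b : R) : 0 < b ->
  (\int[leb]_(x in `[b, +oo[) (x `^ (- 2))%:E = (b^-1)%:E)%E.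
Proof.
move=> b0.
have dF (x : R) : 0 < x -> is_derive x 1 (fun x : R => - x^-1) (x ^- 2).
  move=> x0.
  have H := is_deriveN (@is_deriveV R id x 1 1 (lt0r_neq0 x0) (is_derive_id x 1)).
  by apply: (is_derive_eq H); rewrite /GRing.scale/= mulr1 opprK.
have cV (x : R) : 0 < x -> {for x, continuous (fun x : R => x^-1)}.
  by move=> x0; apply: cvgV; [exact: lt0r_neq0 | exact: cvg_id].
rewrite (@ge0_continuous_FTC2y R _ (fun x => - x^-1) b 0).
- by rewrite -EFinN opprK add0e.
- by move=> x _; exact: powR_ge0.
- apply: continuous_in_subspaceT => x; rewrite inE/= in_itv/= andbT => bx.
  have x0 : 0 < x by exact: lt_le_trans bx.
  apply/differentiable_continuous/derivable1_diffP.
  exact: (@ex_derive _ _ _ _ _ _ _ (is_derive1_powR (- 2) x0)).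
- rewrite -oppr0; apply: cvgN.
  apply/cvgrPdist_le => eps eps0; near=> x.
  rewrite sub0r normrN.
  have x0 : 0 < x by near: x; apply: nbhs_pinfty_gt; rewrite num_real.
  rewrite gtr0_norm ?invr_gt0// invf_ple ?posrE//.
- by move=> x bx; have [] := dF x (lt_trans b0 bx).
- by apply: cvg_at_right_filter; apply: cvgN; exact: cV.
move=> x; rewrite in_itv/= andbT => bx; have x0 := lt_trans b0 bx.
by rewrite derive1E (@derive_val _ _ _ _ _ _ _ (dF x x0)) powRN2// ltW.
Unshelve. all: by end_near. Qed.

End InverseSquare.

(** * The law of [Y] as a Borel measure on the line *)

Section BorelRV.
Context (R : realType) (d : measure_display) (T : measurableType d)
  (P : probability T R) (Y : {RV P >-> R}).

(* The Borel structures of R and of measurableTypeR R have the same measurable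
   sets but different displays; Lebesgue measure lives on the latter. *)
Definition borelRV : T -> measurableTypeR R := Y.

Let measurable_borelRV : measurable_fun setT borelRV.
Proof. exact: (@measurable_funPT _ _ _ _ Y). Qed.

HB.instance Definition _ := isMeasurableFun.Build _ _ _ _ borelRV measurable_borelRV.

Definition law : probability (measurableTypeR R) R := distribution P borelRV.

End BorelRV.

(** * Integration against a law with a density *)

Section Density.
Context (R : realType) (d : measure_display) (T : measurableType d).
Variables (P : probability T R) (Y : {RV P >-> R}) (g : R -> R).
Hypothesis Yg : has_density Y g.
Local Notation leb := (@lebesgue_measure R).

Let mg : measurable_fun setT (g : measurableTypeR R -> R). Proof. by case: Yg. Qed.
Let g_ge0 x : 0 <= g x. Proof. by case: Yg. Qed.
Let gE (A : set (measurableTypeR R)) : measurable A -> law Y A = (\int[leb]_(x in A) (g x)%:E)%E.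
Proof. by case: Yg => _ _; exact. Qed.
Let mgE : measurable_fun setT (EFin \o (g : measurableTypeR R -> R)). Proof. exact/measurable_EFinP. Qed.

Lemma law_dominated : law Y `<< leb.
Proof.
apply/null_content_dominatesP => A mA A0; rewrite gE//.
by apply: null_set_integral => //; exact: measurable_funTS.
Qed.

(** The formula holds for the Radon-Nikodym derivative [h] of the law, and [g] equals [h] almost
    everywhere, having the same integral over every measurable set. *)
Lemma ge0_integral_density (f : measurableTypeR R -> \bar R) (E : set (measurableTypeR R)) :
  (forall x, (0 <= f x)%E) -> measurable E -> measurable_fun setT f ->
  (\int[law Y]_(x in E) f x = \int[leb]_(x in E) (f x * (g x)%:E))%E.
Proof.
move=> f0 mE mf.
pose h := @Radon_Nikodym_SigmaFinite.f _ (measurableTypeR R) R (law Y) leb.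
have ih : leb.-integrable setT h.
  exact: Radon_Nikodym_SigmaFinite.f_integrable law_dominated.
have hg : ae_eq leb setT h (EFin \o (g : measurableTypeR R -> R)).
  apply: integral_ae_eq => // A _ mA.
  by rewrite -(Radon_Nikodym_SigmaFinite.f_integral law_dominated)//; exact: gE.
rewrite -(Radon_Nikodym_SigmaFinite.change_of_variables law_dominated)//; last first.
  exact: measurable_funTS.
have mh : measurable_fun setT h by exact: measurable_int ih.
apply: ae_eq_integral => //.
- by apply: measurable_funTS; exact: emeasurable_funM.
- by apply: measurable_funTS; exact: emeasurable_funM.
by apply: filterS hg => x /(_ I) hx _ /=; rewrite -/h hx.
Qed.

Hypothesis Y_ge0 : forall t, 0 <= Y t.

Lemma moment_law k : (moment Y k =
  \int[law Y]_(x in `[0%R, +oo[%classic) (x ^+ k)%:E)%E.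
Proof.
rewrite /moment unlock [RHS]integral_mkcond.
rewrite ge0_integral_distribution.
- apply: eq_integral => t _ /=; rewrite patchE mem_set//=.
  by rewrite in_itv/= Y_ge0.
- apply/(measurable_restrictT _ _).1 => //; apply/measurable_EFinP.
  exact: measurable_funX.
move=> y; rewrite patchE; case: ifPn => //; rewrite inE/= in_itv/= andbT => y0.
by rewrite lee_fin exprn_ge0.
Qed.

Lemma law_nneg : law Y `[0, +oo[%classic = 1%E.
Proof.
rewrite /law /distribution/= /pushforward -(probability_setT P); congr (P _).
by apply/seteqP; split => // t _ /=; rewrite in_itv/= Y_ge0.
Qed.

(* Y = 0 has probability 0 because Y has a density. *)
Lemma moment_gt0 k : (0 < moment Y k)%E.
Proof.
have Ek0 : moment Y k = (\int[P]_t (Y t ^+ k)%:E)%E by rewrite /moment unlock.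
have mY : measurable_fun setT (fun t => Y t ^+ k).
  by apply: measurable_funX; exact: measurable_funPT.
rewrite lt0e; apply/andP; split; last first.
  by rewrite Ek0; apply: integral_ge0 => t _; rewrite lee_fin exprn_ge0.
apply/eqP => E0.
have : (\int[P]_t `|(Y t ^+ k)%:E| = 0)%E.
  rewrite -E0 Ek0; apply: eq_integral => t _.
  by rewrite gee0_abs// lee_fin exprn_ge0.
move/(ae_eq_integral_abs P measurableT) => /(_ _)[].
  exact/measurable_EFinP.
move=> N [mN N0 HN].
have mY0 : measurable (Y @^-1` [set 0%R]).
  by rewrite -[X in measurable X]setTI; exact: measurable_funPT.
have : (P setT <= P (N `|` Y @^-1` [set 0%R]))%E.
  apply: le_measure; rewrite ?inE//; first exact: measurableU.
  move=> t _; have [Nt|Nt] := pselect (N t); [by left|right].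
  have /contrapT := (subsetC HN) t Nt.
  by move=> /(_ I) [] /eqP; rewrite expf_eq0 => /andP[_ /eqP].
rewrite probability_setT leNgt => /negP; apply.
apply: le_lt_trans (measureU2 _ mN mY0) _.
have Y00 : P (Y @^-1` [set 0%R]) = 0%E.
  by have := gE (measurable_set1 0); rewrite integral_set1.
apply: (@le_lt_trans _ _ 0%E); last by rewrite lte_fin.
rewrite -[leRHS]adde0; apply: leeD.
  by move: N0 => /eqP; rewrite eq_le => /andP[].
by move: Y00 => /eqP; rewrite eq_le => /andP[].
Qed.

End Density.

(** * Carleman's condition from the decay of the density *)

Section CarlemanFromDensity.
Context (R : realType) (d : measure_display) (T : measurableType d).
Variables (P : probability T R) (Y : {RV P >-> R}) (g : R -> R) (a : R).
Hypothesis Y_ge0 : forall t, 0 <= Y t.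
Hypothesis moments_fin : forall k : nat, (1 <= k)%N -> (moment Y k < +oo)%E.
Hypothesis Yg : has_density Y g.
Hypothesis a_gt1 : 1 < a.
Hypothesis g_gt0 : forall x, a <= x -> 0 < g x.
Hypothesis g_mono : forall x y, a <= x -> x <= y ->
  - ln (g x) / ln x <= - ln (g y) / ln y.
Local Notation leb := (@lebesgue_measure R).

Let m (k : nat) : R := fine (moment Y k).
Let decay (x : R) : R := - ln (g x) / ln x.

Lemma moment_fineE k : moment Y k = (m k)%:E.
Proof.
rewrite /m fineK// ge0_fin_numE ?(ltW (moment_gt0 Yg Y_ge0 k))//.
(* The moment of order 0 is the mass of the half line. *)
case: k => [|k]; last exact: moments_fin.
rewrite (moment_law Y_ge0); under eq_integral do rewrite expr0.
rewrite integral_cst// mul1e; apply: le_lt_trans (ltry 1); exact: probability_le1.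
Qed.

Lemma fine_moment_gt0 k : 0 < m k.
Proof. by have := moment_gt0 Yg Y_ge0 k; rewrite moment_fineE lte_fin. Qed.

(** Monotonicity carries the bound from [u] to [y], where it says that [g y] is at most the inverse
    of [y ^+ k.+2]. *)
Lemma density_decay k (u y : R) : a <= u -> k.+2%:R <= decay u -> u <= y ->
  y ^+ k * g y <= y `^ (- 2).
Proof.
move=> au ku uy; have ay := le_trans au uy.
have y1 : 1 < y := lt_le_trans a_gt1 ay.
have y0 : 0 < y by exact: lt_trans y1.
have gy : g y <= (y ^+ k.+2)^-1.
  rewrite -[leLHS](lnK (g_gt0 ay)) -[X in X^-1]lnK ?posrE ?exprn_gt0//.
  rewrite -expRN ler_expR lnXn// -mulr_natl lerNr.
  by rewrite -ler_pdivlMr ?ln_gt0//; exact: le_trans (g_mono au uy).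
rewrite (powRN2 (ltW y0)).
apply: (@le_trans _ _ (y ^+ k * (y ^+ k.+2)^-1)).
  by rewrite ler_wpM2l ?exprn_ge0// ltW.
have -> : k.+2 = (k + 2)%N by rewrite addn2.
by rewrite exprD invfM mulrA divff ?mul1r// expf_neq0// gt_eqF.
Qed.

(** Split at [u]. Below, the integrand is at most [u ^+ k]; above, [density_decay] leaves the
    integral of the inverse square, and [u^-1 <= 1 <= u ^+ k]. *)
Lemma moment_le k (u : R) : a <= u -> k.+2%:R <= decay u -> m k <= 2 * u ^+ k.
Proof.
move=> au ku.
have u1 : 1 < u := lt_le_trans a_gt1 au.
have u0 : 0 < u by exact: lt_trans u1.
have mX (D : set (measurableTypeR R)) :
    measurable_fun D (fun x : measurableTypeR R => (x ^+ k)%:E).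
  by apply: measurable_funTS; apply/measurable_EFinP; exact: measurable_funX.
have mg : measurable_fun setT (g : measurableTypeR R -> R) by case: Yg.
rewrite -lee_fin -moment_fineE (moment_law Y_ge0).
have -> : `[0%R, +oo[%classic = `[0%R, u[%classic `|` `[u, +oo[%classic :> set R.
  apply/seteqP; split => x /=; rewrite !in_itv/= !andbT.
    by move=> x0; have [xu|xu] := ltP x u; [left; rewrite x0|right].
  by move=> [/andP[]//|]; exact: le_trans (ltW u0).
rewrite ge0_integral_setU//=; last 2 first.
- move=> x [|]; rewrite /= !in_itv/= ?andbT.
    by move=> /andP[x0 _]; rewrite lee_fin exprn_ge0.
  by move=> ux; rewrite lee_fin exprn_ge0// (le_trans (ltW u0)).
- apply/disj_setPS => x [] /=; rewrite !in_itv/= !andbT => /andP[_ xu] ux.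
  by move: xu; rewrite ltNge ux.
have -> : 2 * u ^+ k = u ^+ k + u ^+ k by ring.
rewrite EFinD; apply: leeD.
  apply: (@le_trans _ _ (\int[law Y]_(x in `[0%R, u[%classic) (u ^+ k)%:E)%E).
    apply: ge0_le_integral => //=.
    - by move=> x; rewrite in_itv/= => /andP[x0 _]; rewrite lee_fin exprn_ge0.
    move=> x; rewrite in_itv/= => /andP[x0 xu].
    by rewrite lee_fin lerXn2r ?nnegrE// ltW.
  rewrite integral_cst// -[leRHS]mule1; apply: lee_wpmul2l.
    by rewrite lee_fin exprn_ge0// ltW.
  by apply: probability_le1; exact: measurable_itv.
(* The absolute value makes the integrand nonnegative on the whole line, as [ge0_integral_density]
   requires. *)
have -> : (\int[law Y]_(x in `[u, +oo[%classic) (x ^+ k)%:E =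
    \int[law Y]_(x in `[u, +oo[%classic) (`|x| ^+ k)%:E)%E.
  apply: eq_integral => x; rewrite inE/= in_itv/= andbT => ux.
  by rewrite ger0_norm// (le_trans (ltW u0)).
have mnX : measurable_fun setT (fun x : measurableTypeR R => (`|x| ^+ k)%:E).
  by apply/measurable_EFinP; apply: measurable_funX; exact: normr_measurable.
rewrite (ge0_integral_density Yg)//.
  apply: (@le_trans _ _ (\int[leb]_(x in `[u, +oo[%classic) (x `^ (- 2))%:E)%E).
    apply: ge0_le_integral => //=.
    - by move=> x _; rewrite -EFinM lee_fin mulr_ge0 ?exprn_ge0//; case: Yg.
    - apply: measurable_funTS; apply: emeasurable_funM => //.
      exact/measurable_EFinP.
    - apply: measurable_funTS; apply/measurable_EFinP.
      exact: measurable_powR.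
    move=> x; rewrite in_itv/= andbT => ux.
    rewrite -EFinM lee_fin ger0_norm ?(le_trans (ltW u0))//.
    exact: (@density_decay k u).
  rewrite integral_powRN2// lee_fin (@le_trans _ _ 1)//.
    by rewrite invf_le1// ltW.
  by rewrite exprn_ege1// ltW.
Qed.

Let threshold (k : nat) : R := (m k / 2) `^ ((2 * k)%:R^-1).

Lemma threshold_gt0 k : 0 < threshold k.
Proof. by rewrite powR_gt0// divr_gt0// fine_moment_gt0. Qed.

Lemma threshold_le k (x : R) : (0 < k)%N -> a <= x ->
  k.+2%:R <= decay (x ^+ 2) -> threshold k <= x.
Proof.
move=> k0 ax kx.
have x1 : 1 < x := lt_le_trans a_gt1 ax.
have x0 : 0 <= x by rewrite ltW// (lt_trans _ x1).
have ax2 : a <= x ^+ 2 by rewrite (le_trans ax)// expr2 ler_peMr// ltW.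
have kn0 : (2 * k)%:R != 0 :> R by rewrite pnatr_eq0 muln_eq0/= -lt0n.
have -> : x = (x ^+ (2 * k)) `^ ((2 * k)%:R^-1).
  by rewrite -powR_mulrn// -powRrM divff// powRr1.
apply: ge0_ler_powR; rewrite ?invr_ge0 ?nnegrE ?exprn_ge0//.
  by rewrite divr_ge0// ltW// fine_moment_gt0.
by rewrite ler_pdivrMr// mulrC exprM; exact: moment_le.
Qed.

(** The 2 inside [threshold] enters through its root of order [2 * k], which is at most 2. *)
Lemma inv_threshold_le k : (0 < k)%N ->
  (threshold k)^-1 <= 2 * m k `^ (- ((2 * k)%:R^-1)).
Proof.
move=> k0; have mk0 := fine_moment_gt0 k.
rewrite -[leLHS]powR_inv1; last by rewrite ltW// threshold_gt0.
rewrite /threshold -powRrM mulrN1 powRM ?invr_ge0//; last exact: ltW.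
rewrite mulrC ler_wpM2r ?powR_ge0//.
rewrite -[2^-1]powR_inv1// -powRrM mulrNN mul1r ler1_powR ?ler1n//.
by rewrite invf_le1 ?ltr0n ?ler1n muln_gt0 k0.
Qed.

(** The factor 2 comes from [ln (x ^+ 2) = 2 * ln x]: on the ray from [a], [decay (x ^+ 2)] times
    this weight is the integrand of [g_int]. *)
Let weight (x : measurableTypeR R) : \bar R := (2 * x `^ (- 2))%:E.

Let weight_ge0 x : (0 <= weight x)%E.
Proof. by rewrite lee_fin mulr_ge0// powR_ge0. Qed.

Let measurable_weight (D : set (measurableTypeR R)) : measurable_fun D weight.
Proof.
apply: measurable_funTS; apply/measurable_EFinP; apply: measurable_funM => //.
Qed.

Let integral_weight (b : R) : 0 < b ->
  (\int[leb]_(x in `[b, +oo[) weight x = (2 * b^-1)%:E)%E.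
Proof.
move=> b0; rewrite /weight; under eq_integral do rewrite EFinM.
rewrite ge0_integralZl//= ?integral_powRN2//.
- apply: measurable_funTS; apply/measurable_EFinP; exact: measurable_powR.
- by move=> x _; rewrite lee_fin powR_ge0.
Qed.

(** The shift leaves out index 0, where the exponent in [threshold] is the default value
    [0^-1 = 0]. *)
Let step (k : nat) : measurableTypeR R -> \bar R :=
  weight \_ `[threshold k.+1, +oo[%classic.

Let step_ge0 k x : (0 <= step k x)%E.
Proof. by rewrite /step patchE; case: ifPn. Qed.

(* decay (x^2) is at most 3 plus the number of indices k >= 1 with k + 2 <= decay (x^2),
   and every such k satisfies threshold k <= x. *)
Lemma weighted_decay_le_count (x : R) : a <= x ->
  ((decay (x ^+ 2) * (2 * x `^ (- 2)))%:E
    <= 3%:E * weight x + \sum_(0 <= k <oo) step k x)%E.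
Proof.
move=> ax; set h := decay _; set w := 2 * _.
have w0 : 0 <= w by rewrite mulr_ge0// powR_ge0.
have [h3|h3] := leP h 3.
  apply: (@le_trans _ _ (3%:E * weight x)%E).
    by rewrite -EFinM lee_fin ler_wpM2r.
  by rewrite leeDl// nneseries_ge0.
pose N := Num.truncn h.
have h0 : 0 <= h by rewrite (le_trans _ (ltW h3)).
have /andP[Nh hN] : N%:R <= h < N.+1%:R by exact: truncn_itv.
have N3 : (3 <= N)%N by rewrite truncn_ge_nat// ltW.
(* [step k] belongs to the index [k.+1], which counts as soon as [k.+3 <= N]. This gives [N - 2]
   terms, and [h < N.+1 = (N - 2) + 3]. *)
apply: (@le_trans _ _ (3%:E * weight x + \sum_(0 <= k < N - 2) step k x)%E); last first.
  by rewrite leeD2l// nneseries_lim_ge.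
have -> : (\sum_(0 <= k < N - 2) step k x = ((N - 2)%:R * w)%:E)%E.
  rewrite (eq_big_nat _ _ (F2 := fun=> w%:E)); last first.
    move=> k /andP[_ kN]; rewrite /step patchE mem_set//= in_itv/= andbT.
    apply: threshold_le => //; apply: le_trans Nh; rewrite ler_nat.
    by move: kN N3; lia.
  by rewrite sumEFin sumr_const_nat subn0 mulr_natl.
rewrite -EFinM -EFinD lee_fin -mulrDl ler_wpM2r// natrB; last by exact: ltnW.
by move: hN; rewrite -natr1; lra.
Qed.

Hypothesis g_int : (\int[leb]_(x in `[a, +oo[)
  (- ln (g (x ^+ 2)) / (x ^+ 2 * ln x))%:E = +oo)%E.

Theorem carleman_of_density : carleman_stieltjes Y.
Proof.
(* The inverse is written as a real power to get measurability on the whole line by composition;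
   from [a] on, [J] is the integrand of [g_int]. *)
pose J (x : measurableTypeR R) : \bar R :=
  (- ln (g (x ^+ 2)) * (x ^+ 2 * ln x) `^ (- 1))%:E.
have mg : measurable_fun setT (g : measurableTypeR R -> R) by case: Yg.
have mJ : measurable_fun setT J.
  apply/measurable_EFinP; apply: measurable_funM.
    apply: measurableT_comp => //; apply: (measurableT_comp (@measurable_ln R)).
    by apply: (measurableT_comp mg); exact: measurable_funX.
  apply: (measurableT_comp (measurable_powR (- 1))).
  apply: measurable_funM; first exact: measurable_funX.
  exact: measurable_ln.
have a0 : 0 < a by exact: lt_trans a_gt1.
have JE x : a <= x -> J x = (decay (x ^+ 2) * (2 * x `^ (- 2)))%:E /\
    J x = (- ln (g (x ^+ 2)) / (x ^+ 2 * ln x))%:E.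
  move=> ax; have x1 : 1 < x := lt_le_trans a_gt1 ax.
  have x0 : 0 < x by exact: lt_trans x1.
  have lx : 0 < ln x by exact: ln_gt0.
  rewrite /J powR_inv1 ?mulr_ge0 ?exprn_ge0 ?ltW//; split => //.
  rewrite /decay (powRN2 (ltW x0)) lnXn// -mulr_natl; congr EFin.
  by field; rewrite !gt_eqF.
have J_int : (\int[leb]_(x in `[a, +oo[) J x = +oo)%E.
  rewrite -[RHS]g_int; apply: eq_integral => x.
  by rewrite inE/= in_itv/= andbT => /JE[].
(* [J] may be negative near [a]; its positive part obeys the same bound, whose right-hand side is
   nonnegative. *)
have Jpos : (\int[leb]_(x in `[a, +oo[) J^\+ x = +oo)%E.
  apply/eqP; rewrite -leye_eq -[leLHS]J_int integralE.
  rewrite -[leRHS]adde0; apply: leeD => //.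
  by rewrite oppe_le0 integral_ge0.
have mstep k (D : set (measurableTypeR R)) : measurable D -> measurable_fun D (step k).
  move=> mD; apply: measurable_funTS.
  by apply/(measurable_restrictT _ _).1 => //; exact: measurable_itv.
have msum (D : set (measurableTypeR R)) : measurable D ->
    measurable_fun D (fun x => \sum_(0 <= k <oo) step k x)%E.
  by move=> mD; apply: (@ge0_emeasurable_sum _ _ _ _ step xpredT) => // k _; exact: mstep.
have m3w (D : set (measurableTypeR R)) : measurable_fun D (fun x => 3%:E * weight x)%E.
  exact: measurable_funeM.
have : (+oo <= \int[leb]_(x in `[a, +oo[)
    (3%:E * weight x + \sum_(0 <= k <oo) step k x))%E.
  rewrite -Jpos; apply: ge0_le_integral => //=.
  - by apply: measurable_funTS; exact: measurable_funepos.
  - by apply: emeasurable_funD => //; exact: msum.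
  move=> x; rewrite in_itv/= andbT => ax; rewrite funeposE ge_max.
  rewrite {1}(JE x ax).1 weighted_decay_le_count//=.
  by rewrite adde_ge0 ?mule_ge0 ?nneseries_ge0.
rewrite ge0_integralD//=; last 3 first.
- by move=> x _; rewrite mule_ge0.
- by move=> x _; exact: nneseries_ge0.
- exact: msum.
rewrite ge0_integralZl//= integral_weight// integral_nneseries//; last first.
  by move=> k; exact: mstep.
(* The 4 is 2 from [weight] times 2 from [inv_threshold_le]. *)
have step_int k : (\int[leb]_(x in `[a, +oo[) step k x <=
    4%:E * (m k.+1 `^ (- ((2 * k.+1)%:R^-1)))%:E)%E.
  rewrite /step -integral_mkcondr.
  apply: (@le_trans _ _ (\int[leb]_(x in `[threshold k.+1, +oo[) weight x)%E).
    apply: ge0_subset_integral => //=.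
    exact: measurableI.
  rewrite integral_weight ?threshold_gt0// -EFinM lee_fin.
  have -> x : 4 * x = 2 * (2 * x) :> R by ring.
  by rewrite ler_pM2l// inv_threshold_le.
set S := (\sum_(1 <= k <oo) (m k `^ (- ((2 * k)%:R^-1)))%:E)%E.
have S0 : (0 <= S)%E by apply: nneseries_ge0 => k _ _; rewrite lee_fin powR_ge0.
have stepS : (\sum_(0 <= k <oo) \int[leb]_(x in `[a, +oo[) step k x <= 4%:E * S)%E.
  rewrite /S -(nneseries_addn (f := fun k => (m k `^ (- ((2 * k)%:R^-1)))%:E)); last first.
    by move=> k; rewrite lee_fin powR_ge0.
  rewrite -nneseriesZl; last by move=> k _; rewrite lee_fin powR_ge0.
  apply: lee_nneseries => [k _ _|k _]; first exact: integral_ge0.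
  by rewrite addn1.
rewrite leye_eq -EFinM => /eqP oo.
(* The first summand is the finite number [3 * (2 / a)], so a finite [S] would bound an infinite
   integral. *)
have := leeD2l (3 * (2 / a))%:E stepS; rewrite oo leye_eq.
rewrite /carleman_stieltjes -/S; move: S0; case: S {stepS} => [r|//|//].
by rewrite lee_fin => _; rewrite -EFinM -EFinD.
Qed.

Lemma carleman_partial_sums (A : R) :
  exists K, A <= \sum_(1 <= k < K) m k `^ (- ((2 * k)%:R^-1)).
Proof.
apply/not_existsP => H.
have := carleman_of_density; rewrite /carleman_stieltjes => /eqP; apply/negP.
rewrite -ltey; apply: (@le_lt_trans _ _ A%:E); last by rewrite ltry.
apply: lime_le.
  by apply: is_cvg_nneseries => k _ _; rewrite lee_fin powR_ge0.
apply: nearW => n; rewrite sumEFin lee_fin ltW// ltNge; apply/negP; exact: H.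
Qed.

End CarlemanFromDensity.

Theorem theorem2 (R : realType) (d : measure_display) (T : measurableType d)
    (P : probability T R) (Y : {RV P >-> R}) (g : R -> R) (a : R)
    (Y_ge0 : forall t, 0 <= Y t)
    (moments_fin : forall k : nat, (1 <= k)%N -> (moment Y k < +oo)%E)
    (Yg : has_density Y g)
    (a_gt1 : 1 < a)
    (g_cont : {within `[a, +oo[, continuous g})
    (g_gt0 : forall x, a <= x -> 0 < g x)
    (g_int : (\int[lebesgue_measure]_(x in `[a, +oo[)
                (- ln (g (x ^+ 2)) / (x ^+ 2 * ln x))%:E = +oo)%E)
    (g_mono : forall x y, a <= x -> x <= y ->
       - ln (g x) / ln x <= - ln (g y) / ln y)
    (g_lim : - ln (g x) / ln x @[x --> +oo] --> +oo) :
  carleman_stieltjes Y /\ M_determinate Y.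
Proof.
split; first exact: (carleman_of_density Y_ge0 moments_fin Yg a_gt1 g_gt0 g_mono g_int).
move=> nu nu1 nu_moments A mA; apply/esym.
apply: (@stieltjes_carleman R (law Y) nu (fun k => fine (moment Y k))) => //.
- exact: law_nneg.
- move=> k; rewrite -(moment_fineE Y_ge0 moments_fin Yg).
  by rewrite (moment_law Y_ge0).
- by move=> k; rewrite -(moment_fineE Y_ge0 moments_fin Yg).
- exact: fine_moment_gt0 Y_ge0 moments_fin Yg.
exact: (carleman_partial_sums Y_ge0 moments_fin Yg a_gt1 g_gt0 g_mono g_int).
Qed.
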